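(* There exist a constant $c>0$ and an infinite family $\mathcal{H}$ of finite graphs such that every $H\in\mathcal{H}$ satisfies $\mathrm{iocp}(H)\le 1$ and $\omega(H)\ge 2$, the clique numbers $\omega(H)$ for $H\in\mathcal{H}$ are unbounded, and every $H\in\mathcal{H}$ satisfies $\chi(H)\ge c\,\frac{\omega(H)^2}{\log^2\omega(H)}$.
   Context: The induced odd cycle packing number $\mathrm{iocp}(G)$ of a graph $G$ is the maximum integer $k$ such that $G$ contains an induced subgraph consisting of $k$ pairwise vertex-disjoint odd cycles (triangles count as odd cycles). $\chi$ is the chromatic number and $\omega$ the clique number. *)

(* Defs.v *)
From HB Require Import structures.
From mathcomp Require Import all_boot all_order all_algebra.
From mathcomp Require Import reals exp.
Set Implicit Arguments.
Unset Strict Implicit.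
Unset Printing Implicit Defensive.

Record fin_graph := FinGraph {
  vertex :> finType;
  adj : rel vertex;
  adj_sym : symmetric adj;
  adj_irr : irreflexive adj }.
Arguments adj {f} x y.

Definition isomorphic (G H : fin_graph) : Prop :=
  exists2 f : G -> H, bijective f & forall x y, adj (f x) (f y) = adj x y.

(* Infinitude is taken up to isomorphism: no finite list of graphs
   represents every member of the family. *)
Definition infinite_family (F : fin_graph -> Prop) : Prop :=
  forall (n : nat) (u : 'I_n -> fin_graph),
    exists2 H, F H & forall i, ~ isomorphic (u i) H.

Section Invariants.
Variable G : fin_graph.
Implicit Types (K C D : {set G}) (P : {set {set G}}).

Definition clique K : bool :=
  [forall x in K, forall y in K, (x != y) ==> adj x y].

Definition omega : nat := \max_(K : {set G} | clique K) #|K|.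

Definition colorable (n : nat) : bool :=
  [exists f : {ffun G -> 'I_n}, forall x, forall y, adj x y ==> (f x != f y)].

Lemma colorable_card : exists n, colorable n.
Proof.
exists #|G|; apply/existsP; exists [ffun x => enum_rank x].
apply/forallP=> x; apply/forallP=> y; apply/implyP=> xy.
rewrite !ffunE (inj_eq enum_rank_inj); apply: contraTneq xy => ->.
by rewrite adj_irr.
Qed.

Definition chi : nat := ex_minn colorable_card.

(* The subgraph induced on C is a cycle of odd length n >= 3, enumerated
   cyclically by f; ordS is the successor modulo n on 'I_n. The bound on n
   only serves to make the quantification finite. *)
Definition induces_odd_cycle C : bool :=
  [exists n : 'I_#|G|.+1, [&& 2 < n, odd n &
    [exists f : {ffun 'I_n -> G}, [&& injectiveb f, C == f @: [set: 'I_n] &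
      [forall i, forall j,
        adj (f i) (f j) == ((j == ordS i) || (i == ordS j))]]]]].

(* The subgraph induced on cover P is the disjoint union of the odd cycles
   induced on the members of P: distinct members are disjoint and no edge
   joins them. *)
Definition odd_cycle_packing P : bool :=
  [forall C in P, induces_odd_cycle C] &&
  [forall C in P, forall D in P, (C != D) ==>
    [disjoint C & D] && [forall x in C, forall y in D, ~~ adj x y]].

Definition iocp : nat := \max_(P : {set {set G}} | odd_cycle_packing P) #|P|.

End Invariants.

(* Main.v *)
(** The members of the family are complements of graphs G with no K_{3,3}.
    Two disjoint, mutually nonadjacent odd cycles of the complement contain three
    vertices each, hence give a K_{3,3} in G; likewise an independent set of size 6
    in the complement gives a K_6, so colour classes have at most 5 vertices and
    chi >= n / 5.  It remains to make the independence number of G of order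
    sqrt n log n.  Take G(n, p) with n = 2 k^2 and p = 1 / (4 k), and delete all edges
    of a maximal edge-disjoint family of copies of K_{3,3}.  If a set S of size t
    becomes independent, the edges of G(n, p) inside S are covered by edge-disjoint
    copies of K_{3,3} that meet S in an edge; summing over such families, this has
    probability at most
      (1 - p)^C(t,2) * (1 + (p / (1 - p))^9)^N  <=  exp (- p t^2 / 8),
    where N <= t^2 n^4 is the number of potential copies with an edge inside S.
    This beats the number n^t of sets S once t > 32 k ln n.  Finally, all edges of G
    inside a fixed k-set are dropped, so that omega is at least k. *)

Require Import Defs.
From HB Require Import structures.
From mathcomp Require Import all_boot all_order all_algebra.
From mathcomp Require Import reals sequences exp.
From mathcomp Require Import ring lra zify.
Set Implicit Arguments.
Unset Strict Implicit.
Unset Printing Implicit Defensive.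
Import Order.TTheory GRing.Theory Num.Theory.
Local Open Scope ring_scope.

(** * Random subsets and the deletion method *)

Section Deletion.
Variables (R : realFieldType) (E : finType) (p : R).
Hypotheses (p_ge0 : 0 <= p) (p_lt1 : p < 1).
Implicit Types (A B D X Y : {set E}) (BB F : {set {set E}}).

Let r : R := p / (1 - p).

Let q_gt0 : 0 < 1 - p. Proof. by rewrite subr_gt0. Qed.

Let r_ge0 : 0 <= r. Proof. by rewrite divr_ge0 // ltW. Qed.

Definition bernoulli_weight X : R := \prod_e (if e \in X then p else 1 - p).

Lemma bernoulli_weight_ge0 X : 0 <= bernoulli_weight X.
Proof. by apply: prodr_ge0 => e _; case: ifP => // _; apply: ltW. Qed.

Lemma sum_bernoulli_weight A D : [disjoint A & D] ->
  \sum_(X : {set E} | (A \subset X) && [disjoint X & D]) bernoulli_weight X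
    = p ^+ #|A| * (1 - p) ^+ #|D|.
Proof.
move=> dAD.
pose a e := if e \in D then 0 else p.
pose b e := if e \in A then 0 else 1 - p.
(* The zeros in [a] and [b] kill every [X] that meets [D] or misses a point of [A], so the sum runs
   over all [X] and factors over the elements of [E]. *)
transitivity (\sum_(X : {set E}) \prod_e (if e \in X then a e else b e)).
  rewrite [LHS]big_mkcond; apply: eq_bigr => X _; case: ifP => [/andP[sAX dXD]|].
    apply: eq_bigr => e _; case: ifP => eX; rewrite /a /b.
      by rewrite (disjointFr dXD eX).
    by case: ifP => // /(subsetP sAX); rewrite eX.
  move=> /negbT; rewrite negb_and => /orP[/subsetPn[e eA eX]|/pred0Pn[e /andP[eX eD]]].
    by rewrite (bigD1 e) //= (negbTE eX) /b eA mul0r.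
  by rewrite (bigD1 e) //= [e \in X]eX /a [e \in D]eD mul0r.
rewrite -bigA_distr -!prodr_const [X in X * _]big_mkcond [X in _ * X]big_mkcond.
rewrite -big_split /=; apply: eq_bigr => e _; rewrite /a /b.
case: (boolP (e \in A)) => [eA|_]; first by rewrite (disjointFr dAD eA) addr0 mulr1.
by case: ifP => _; rewrite ?add0r ?mul1r //; ring.
Qed.

Lemma sum_bernoulli_weight1 : \sum_(X : {set E}) bernoulli_weight X = 1.
Proof.
have dis : [disjoint (set0 : {set E}) & (set0 : {set E})].
  by rewrite -setI_eq0 setI0.
have := sum_bernoulli_weight dis; rewrite cards0 !expr0 mulr1 => <-.
by apply: eq_bigl => X; rewrite sub0set -setI_eq0 setI0 eqxx.
Qed.

(** This event occurs whenever deleting a disjoint subfamily [F] of [BB] from [X] leaves nothing of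
    [D]. *)
Definition disjointly_covered BB D X : bool :=
  [exists F : {set {set E}},
    [&& F \subset BB, trivIset F, cover F \subset X & X :&: D \subset cover F]].

(** Union bound over the witness [F]: the set [X] must contain [cover F] and avoid the rest of [D].
    Each covered element costs a factor [p] and saves at most one factor [1 - p], hence [r];
    disjointness splits the power of [r] over the members of [F]. *)
Lemma sum_disjointly_covered BB D :
  \sum_(X | disjointly_covered BB D X) bernoulli_weight X
    <= (1 - p) ^+ #|D| * \prod_(B in BB) (1 + r ^+ #|B|).
Proof.
pose P F X := (cover F \subset X) && (X :&: D \subset cover F).
pose T F := (F \subset BB) && trivIset F.
apply: (@le_trans _ _ (\sum_(F | T F) \sum_(X | P F X) bernoulli_weight X)).
  rewrite (exchange_big_dep predT) //= [leLHS]big_mkcond ler_sum // => X _.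
  have ge0 (Q : pred {set {set E}}) : 0 <= \sum_(F | Q F) bernoulli_weight X.
    by apply: sumr_ge0 => *; apply: bernoulli_weight_ge0.
  case: ifP => // /existsP[F /and4P[sF tF cF iF]].
  by rewrite (bigD1 F) /= ?lerDl ?ge0 // /T /P sF tF cF iF.
have Tle F : T F -> \sum_(X | P F X) bernoulli_weight X
    <= (1 - p) ^+ #|D| * \prod_(B in F) r ^+ #|B|.
  case/andP=> sF /eqP tF; rewrite prodrXr tF.
  have dis : [disjoint cover F & D :\: cover F].
    by rewrite disjoint_sym -setI_eq0 setIDAC setDIl setDv setI0.
  rewrite (eq_bigl (fun X => (cover F \subset X) && [disjoint X & D :\: cover F])); last first.
    by move=> X; rewrite /P -setI_eq0 setIDA setD_eq0.
  rewrite (sum_bernoulli_weight dis) /r expr_div_n mulrCA.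
  apply: ler_wpM2l; first exact: exprn_ge0.
  rewrite ler_pdivlMr ?exprn_gt0 // -exprD.
  apply: ler_wiXn2l; [exact: ltW | by rewrite gerBl |].
  by rewrite -(cardsID (cover F) D) addnC leq_add2l subset_leq_card // subsetIr.
apply: (le_trans (ler_sum _ Tle)).
rewrite -mulr_sumr ler_wpM2l ?exprn_ge0 ?(ltW q_gt0) //.
(* Expanding the product gives a sum over all subfamilies of [BB]; those that are not disjoint only
   add nonnegative terms. *)
rewrite [leRHS]big_mkcond.
rewrite (eq_bigr (fun B => (if B \in BB then r ^+ #|B| else 0) + 1)); last first.
  by move=> B _; case: ifP; rewrite ?add0r // addrC.
rewrite bigA_distr [leLHS]big_mkcond; apply: ler_sum => F _.
case: ifP => [/andP[sF _]|_].
  rewrite [leLHS]big_mkcond; apply: ler_prod => B _.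
  by case: ifP => [/(subsetP sF)->|_]; rewrite ?ler01 ?lexx ?exprn_ge0.
by apply: prodr_ge0 => B _; do 2![case: ifP => //] => *; rewrite exprn_ge0.
Qed.

(* Y is a random X with the members of a maximal disjoint subfamily of BB inside X
   removed. *)
Lemma deletion_hits (I : finType) (D : I -> {set E}) BB :
    set0 \notin BB ->
    \sum_i (1 - p) ^+ #|D i| *
       \prod_(B in BB | ~~ [disjoint B & D i]) (1 + r ^+ #|B|) < 1 ->
  exists2 Y : {set E}, (forall B, B \in BB -> ~~ (B \subset Y)) &
                       (forall i, ~~ [disjoint Y & D i]).
Proof.
move=> BB0 lt1.
pose BD i := [set B in BB | ~~ [disjoint B & D i]].
(* Otherwise the events would cover the whole space, of total weight 1, against the union bound. *)
have /existsP[X /forallP nX] : [exists X : {set E}, [forall i, ~~ disjointly_covered (BD i) (D i) X]].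
  apply: contraTT lt1; rewrite negb_exists -leNgt => /forallP all_cov.
  rewrite -[leLHS]sum_bernoulli_weight1.
  apply: (@le_trans _ _ (\sum_i \sum_(X | disjointly_covered (BD i) (D i) X)
                            bernoulli_weight X)); last first.
    apply: ler_sum => i _; apply: (le_trans (sum_disjointly_covered _ _)).
    by rewrite (eq_bigl (fun B => (B \in BB) && ~~ [disjoint B & D i])) // => B; rewrite inE.
  rewrite (exchange_big_dep predT) //=; apply: ler_sum => X _.
  have /forallPn[i] := all_cov X; rewrite negbK => ci.
  by rewrite (bigD1 i) //= lerDl sumr_ge0 // => *; apply: bernoulli_weight_ge0.
pose Q (M : {set {set E}}) := [&& M \subset BB, trivIset M & cover M \subset X].
have [M /maxsetP[/and3P[sM tM cM] Mmax]] : {M : {set {set E}} | maxset Q M}.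
  apply: ex_maxset; exists set0.
  by rewrite /Q sub0set /cover big_set0 sub0set andbT; apply/trivIsetP => A B; rewrite inE.
have M0 : set0 \notin M by apply: contra BB0; apply: (subsetP sM).
exists (X :\: cover M) => [B BBB|i].
  (* A surviving [B] is disjoint from all of [M], so [B |: M] would contradict maximality. *)
  apply/negP => /subsetP sB.
  have dB : {in M, forall C : {set E}, [disjoint B & C]}.
    move=> C CM; apply/pred0P => e /=; apply/negP => /andP[/sB].
    by rewrite !inE => /andP[/bigcupP nc _] eC; apply: nc; exists C.
  have [tBM BM] := trivIsetU1 dB tM M0.
  case/negP: BM; rewrite -(Mmax (B |: M)) ?setU11 ?subsetUr //.
  rewrite /Q subUset sub1set BBB sM tBM /cover big_setU1 ?subUset ?cM ?andbT /=; last first.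
    apply/negP=> BM; have := dB _ BM; rewrite -setI_eq0 setIid => /eqP B0.
    by move: BBB; rewrite B0; apply/negP.
  by apply/subsetP => e /sB; rewrite inE => /andP[].
(* If nothing of [D i] survives, the members of [M] meeting [D i] cover [X :&: D i]. *)
apply: contra (nX i) => dis; apply/existsP; exists [set B in M | ~~ [disjoint B & D i]].
apply/and4P; split.
- by apply/subsetP => B; rewrite !inE => /andP[/(subsetP sM)-> ->].
- by apply: trivIsetS tM; apply/subsetP => B; rewrite inE => /andP[].
- by apply: subset_trans cM; apply/bigcupsP => B; rewrite inE => /andP[BM _]; apply: bigcup_sup.
apply/subsetP => e /setIP[eX eD].
have : e \in cover M.
  by apply: contraTT eD => eM; rewrite (disjointFr dis) // inE eM.
case/bigcupP => B BM eB; apply/bigcupP; exists B => //; rewrite inE BM /=.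
by apply/pred0Pn; exists e; rewrite /= eB.
Qed.

End Deletion.

(** * Sparse graphs without K_{3,3} and without large independent sets *)

Lemma bin_leq_expn n m : ('C(n, m) <= n ^ m)%N.
Proof.
apply: (@leq_trans (n ^_ m)); first by rewrite -bin_ffact leq_pmulr ?fact_gt0.
elim: m => [|m IHm]; first by rewrite ffactn0.
by rewrite ffactnSr expnSr leq_mul ?leq_subr.
Qed.

Section Bicliques.
Variable V : finType.
Implicit Types (A S : {set V}).

Definition biclique A1 A2 : {set {set V}} := [set [set x; y] | x in A1, y in A2].

Definition K33s : {set {set {set V}}} :=
  [set B | [exists A1 : {set V}, [exists A2 : {set V},
    [&& #|A1| == 3, #|A2| == 3, [disjoint A1 & A2] & B == biclique A1 A2]]]].

Definition pairs S : {set {set V}} := [set e : {set V} | e \subset S & #|e| == 2].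

Lemma K33sP B :
  reflect (exists A1 A2,
             [/\ #|A1| = 3, #|A2| = 3, [disjoint A1 & A2] & B = biclique A1 A2])
          (B \in K33s).
Proof.
rewrite inE; apply: (iffP existsP) => [[A1 /existsP[A2 /and4P[/eqP c1 /eqP c2 d /eqP ->]]]|].
  by exists A1, A2.
by case=> A1 [A2 [c1 c2 d ->]]; exists A1; apply/existsP; exists A2; rewrite c1 c2 d !eqxx.
Qed.

Lemma card_biclique A1 A2 : [disjoint A1 & A2] -> #|biclique A1 A2| = (#|A1| * #|A2|)%N.
Proof.
move=> dA; rewrite /biclique curry_imset2X card_in_imset ?cardsX //.
move=> [x y] [x' y'] /setXP[/= xA yA] /setXP[/= x'A y'A] /setP eq_xy.
congr (_, _).
  have := eq_xy x; rewrite !inE eqxx /= => /esym/orP[/eqP //|/eqP xy'].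
  by move: y'A; rewrite -xy' (disjointFr dA xA).
have := eq_xy y; rewrite !inE eqxx orbT => /esym/orP[/eqP yx'|/eqP //].
by move: yA; rewrite yx' (disjointFr dA x'A).
Qed.

(** Six vertices determine a copy; the two ends of an edge inside [S] are chosen in [S], the other
    four freely. *)
Lemma card_K33s_meeting S :
  (#|[set B in K33s | ~~ [disjoint B & pairs S]]| <= #|S| ^ 2 * #|V| ^ 4)%N.
Proof.
pose g (u : (V * V) * ((V * V) * (V * V))) :=
  biclique [set u.1.1; u.2.1.1; u.2.1.2] [set u.1.2; u.2.2.1; u.2.2.2].
have -> : (#|S| ^ 2 * #|V| ^ 4)%N = #|setX (setX S S) [set: (V * V) * (V * V)]|.
  by rewrite !cardsX cardsT !card_prod; lia.
apply: leq_trans (leq_imset_card g _); apply: subset_leq_card.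
apply/subsetP => B; rewrite inE => /andP[/K33sP[A1 [A2 [c1 c2 d ->]]] /pred0Pn[e]].
rewrite /= inE => /andP[/imset2P[x y xA yA ->] /andP[]].
rewrite subUset !sub1set => /andP[xS yS] _.
have split3 A a : #|A| = 3 -> a \in A -> exists b c, A = [set a; b; c].
  move=> cA aA; have /eqP/cards2P[b [c [_ E]]] : #|A :\ a| = 2.
    by move: (cardsD1 a A); rewrite aA cA => -[].
  by exists b, c; rewrite -(setD1K aA) E setUA.
have [b [c E1]] := split3 _ _ c1 xA; have [b' [c' E2]] := split3 _ _ c2 yA.
apply/imsetP; exists ((x, y), ((b, c), (b', c'))); last by rewrite E1 E2.
by rewrite !inE /= xS yS.
Qed.

Lemma sparse_K33_free (R : realType) (k t : nat) :
    (0 < k)%N -> #|V| = (2 * k ^ 2)%N -> (1 < t)%N ->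
    32 * k%:R * ln (2 * k%:R ^+ 2 : R) < t%:R ->
  exists2 Y : {set {set V}}, (forall B, B \in K33s -> ~~ (B \subset Y)) &
    (forall S, #|S| = t -> ~~ [disjoint Y & pairs S]).
Proof.
move=> k_gt0 cV t_gt1 lt_t.
have k_ge1 : 1 <= k%:R :> R by rewrite ler1n.
have t_gt0 : 0 < t%:R :> R by rewrite ltr0n ltnW.
pose p : R := (4 * k%:R)^-1.
have pk : p * k%:R = 4^-1 by rewrite /p; field; rewrite lt0r_neq0 //; lra.
have p_gt0 : 0 < p by rewrite invr_gt0; lra.
have p_le : p <= 4^-1 by rewrite -pk ler_peMr // ltW.
have p_lt1 : p < 1 by lra.
pose r := p / (1 - p).
have r_ge0 : 0 <= r by rewrite divr_ge0 //; lra.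
have r_le : r <= 2 * p by rewrite /r ler_pdivrMr; [nra|lra].
have K0 : set0 \notin K33s.
  apply/negP => /K33sP[A1 [A2 [c1 c2 d /esym/eqP]]].
  by rewrite -cards_eq0 card_biclique // c1 c2.
pose I := {S : {set V} | #|S| == t}.
have bound (i : I) : (1 - p) ^+ #|pairs (val i)| *
       \prod_(B in K33s | ~~ [disjoint B & pairs (val i)]) (1 + r ^+ #|B|)
     <= expR (- (p * t%:R ^+ 2 / 8)).
  set S := val i; have cS : #|S| = t by apply/eqP/(valP i).
  rewrite (eq_bigl [in [set B in K33s | ~~ [disjoint B & pairs S]]]); last first.
    by move=> B; rewrite [RHS]inE.
  rewrite (eq_bigr (fun=> 1 + r ^+ 9)); last first.
    move=> B /setIdP[/K33sP[A1 [A2 [c1 c2 d ->]]] _].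
    by rewrite card_biclique // c1 c2.
  rewrite prodr_const; set N := #|[set B in K33s | _]|.
  have leN : (N <= t ^ 2 * (2 * k ^ 2) ^ 4)%N by rewrite -cS -cV; exact: card_K33s_meeting.
  rewrite cards_draws cS.
  apply: (@le_trans _ _ (expR (- p) ^+ 'C(t, 2) * expR (r ^+ 9) ^+ N)).
    have q_ge0 : 0 <= 1 - p by lra.
    have r9_ge0 : 0 <= 1 + r ^+ 9 by rewrite addr_ge0 ?exprn_ge0.
    by apply: ler_pM; rewrite ?exprn_ge0 // lerXn2r ?nnegrE ?expR_ge0 ?expR_ge1Dx.
  rewrite -!expRM_natl -expRD ler_expR.
  (* This uses [t >= 2]. The non-edges then contribute at most [- p t^2 / 4] to the exponent, and
     the copies may give back half of that. *)
  have c2 : t%:R ^+ 2 <= 4 * 'C(t, 2)%:R :> R.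
    rewrite -natrX -natrM ler_nat.
    have := bin_ffact t 2; rewrite !ffactnSr ffactn0 !factS fact0; nia.
  have Nr : N%:R * r ^+ 9 <= p * t%:R ^+ 2 / 8.
    apply: (@le_trans _ _ ((t ^ 2 * (2 * k ^ 2) ^ 4)%:R * (2 * p) ^+ 9)).
      by apply: ler_pM; rewrite ?ler_nat ?exprn_ge0 // lerXn2r ?nnegrE //; lra.
    rewrite natrM !natrX natrM natrX.
    have -> : t%:R ^+ 2 * (2 * k%:R ^+ 2) ^+ 4 * (2 * p) ^+ 9
            = 2 ^+ 13 * t%:R ^+ 2 * p * (p * k%:R) ^+ 8 by ring.
    (* Since [p k = 1/4], the constant is 2^13 / 4^8 = 1/8. *)
    by rewrite pk le_eqVlt; apply/orP; left; apply/eqP; field.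
  have : p * t%:R ^+ 2 <= p * (4 * 'C(t, 2)%:R) by rewrite ler_pM2l.
  lra.
have [] := @deletion_hits R _ p (ltW p_gt0) p_lt1 I (fun i => pairs (val i)) K33s K0.
  apply: (le_lt_trans (ler_sum _ (fun i _ => bound i))).
  rewrite sumr_const card_sig -[ltLHS]mulr_natl.
  have -> : #|[pred S : {set V} | #|S| == t]| = 'C(2 * k ^ 2, t).
    by rewrite -cV -card_draws; apply: eq_card => S; rewrite !inE.
  apply: (@le_lt_trans _ _ ((2 * k%:R ^+ 2) ^+ t * expR (- (p * t%:R ^+ 2 / 8)))).
    by rewrite ler_wpM2r ?expR_ge0 // -natrX -natrM -natrX ler_nat bin_leq_expn.
  have n_gt0 : 0 < 2 * k%:R ^+ 2 :> R by nra.
  rewrite -[X in X ^+ t]lnK ?posrE // -expRM_natl -expRD -[ltRHS]expR0 ltr_expR.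
  (* As [8 / p = 32 k], the exponent is negative exactly when [t] exceeds the threshold in the
     hypothesis. *)
  have -> : t%:R * ln (2 * k%:R ^+ 2) + - (p * t%:R ^+ 2 / 8)
          = p * t%:R / 8 * (32 * k%:R * ln (2 * k%:R ^+ 2) - t%:R).
    set L := ln _; rewrite mulrBr.
    have -> : p * t%:R / 8 * (32 * k%:R * L) = 4 * (p * k%:R) * t%:R * L by field.
    by rewrite pk; field.
  by rewrite pmulr_rlt0 ?subr_lt0 // divr_gt0 ?mulr_gt0.
move=> Y YK YS; exists Y => // S /eqP cS.
exact: (YS (exist _ S cS)).
Qed.

End Bicliques.

Lemma subset_of_card (T : finType) (A : {set T}) n :
  (n <= #|A|)%N -> exists2 B : {set T}, B \subset A & #|B| = n.
Proof.
rewrite -bin_gt0 -cards_draws => /card_gt0P[B].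
by rewrite inE => /andP[sBA /eqP cB]; exists B.
Qed.

Lemma omega_isomorphic (G H : fin_graph) : isomorphic G H -> (omega H <= omega G)%N.
Proof.
case=> f [g fK gK] adjf; apply/bigmax_leqP => Q clQ.
rewrite -(card_imset _ (can_inj gK)); apply: leq_bigmax_cond.
apply/forall_inP => _ /imsetP[x xQ ->]; apply/forall_inP => _ /imsetP[y yQ ->].
rewrite (inj_eq (can_inj gK)) -adjf !gK.
by move: clQ => /forall_inP/(_ _ xQ)/forall_inP/(_ _ yQ).
Qed.

(** * Packing number and chromatic number when the complement has no K_{3,3} *)

Section CoK33Free.
Variable H : fin_graph.
Hypothesis linked : forall A1 A2 : {set H}, #|A1| = 3 -> #|A2| = 3 ->
  [disjoint A1 & A2] -> exists x y, [/\ x \in A1, y \in A2 & adj x y].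

Lemma linked_geq3 (C D : {set H}) : (2 < #|C|)%N -> (2 < #|D|)%N -> [disjoint C & D] ->
  exists x y, [/\ x \in C, y \in D & adj x y].
Proof.
move=> /subset_of_card[A1 s1 c1] /subset_of_card[A2 s2 c2] dCD.
have [x [y [xA yA xy]]] := linked c1 c2 (disjointWl s1 (disjointWr s2 dCD)).
by exists x, y; rewrite (subsetP s1) ?(subsetP s2).
Qed.

Lemma iocp_le1 : (iocp H <= 1)%N.
Proof.
apply/bigmax_leqP => P /andP[/forall_inP cyc /forall_inP sep].
have cycle_gt2 C : C \in P -> (2 < #|C|)%N.
  move=> /cyc/existsP[n /and3P[n_gt2 _ /existsP[f /and3P[/injectiveP f_inj /eqP -> _]]]].
  by rewrite card_imset // cardsT card_ord.
rewrite leqNgt; apply/card_gt1P => -[C [D [CP DP neqCD]]].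
have /forall_inP/(_ _ DP) := sep _ CP; rewrite neqCD => /andP[dCD /forall_inP nadj].
have [x [y [xC yD xy]]] := linked_geq3 (cycle_gt2 _ CP) (cycle_gt2 _ DP) dCD.
by have /forall_inP/(_ _ yD) := nadj _ xC; rewrite xy.
Qed.

Lemma card_le_chi : (#|H| <= 5 * chi H)%N.
Proof.
rewrite /chi; case: ex_minnP => m /existsP[f /forallP col] _.
rewrite -sum1_card (partition_big f predT) //=.
rewrite mulnC -[X in (X * _)%N](card_ord m) -sum_nat_const; apply: leq_sum => i _.
rewrite sum1dep_card leqNgt; apply/negP => gt5; set S := [set x | _] in gt5.
(* Six vertices of one colour would split into two triples joined by an edge. *)
have [A1 s1 c1] := subset_of_card (leq_trans (isT : 3 <= 6)%N gt5).
have c2 : (2 < #|S :\: A1|)%N by rewrite cardsD (setIidPr s1) c1; lia.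
have dA : [disjoint A1 & S :\: A1] by rewrite -setI_eq0 setIDA setDIl setDv set0I.
have [x [y [xA yA xy]]] := linked_geq3 (eq_leq (esym c1)) c2 dA.
have /forallP/(_ y) := col x; rewrite xy /=.
move: (subsetP s1 _ xA) yA; rewrite !inE => /eqP -> /andP[_ /eqP ->].
by rewrite eqxx.
Qed.

End CoK33Free.

(** * Complement graph with a planted clique *)

Section Cograph.
Variables (V : finType) (Y : {set {set V}}) (K : {set V}).

(* Y is the edge set of G; every pair inside K becomes an edge of the complement. *)
Definition coadj : rel V :=
  fun x y => (x != y) && (([set x; y] \notin Y) || (x \in K) && (y \in K)).

Lemma coadj_sym : symmetric coadj.
Proof. by move=> x y; rewrite /coadj eq_sym setUC [(x \in K) && _]andbC. Qed.

Lemma coadj_irr : irreflexive coadj.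
Proof. by move=> x; rewrite /coadj eqxx. Qed.

Definition cograph := FinGraph coadj_sym coadj_irr.

Lemma cograph_linked (A1 A2 : {set cograph}) :
    (forall B, B \in K33s V -> ~~ (B \subset Y)) ->
    #|A1| = 3 -> #|A2| = 3 -> [disjoint A1 & A2] ->
  exists x y, [/\ x \in A1, y \in A2 & @adj cograph x y].
Proof.
move=> YK c1 c2 dA.
have /subsetPn[e /imset2P[x y xA yA ->] exy] : ~~ (biclique A1 A2 \subset Y).
  by apply: YK; apply/K33sP; exists A1, A2.
exists x, y; split=> //; rewrite /= /coadj exy andbT.
by apply: contraTneq yA => <-; rewrite (disjointFr dA xA).
Qed.

Lemma omega_cograph_ge : (#|K| <= omega cograph)%N.
Proof.
apply: (@leq_bigmax_cond _ (@clique cograph) (fun Q : {set V} => #|Q|) K).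
apply/forall_inP => x xK; apply/forall_inP => y yK.
by apply/implyP => xy; rewrite /= /coadj xy xK yK orbT.
Qed.

(** Outside [K] no edges are planted, so the part of a clique there contains no pair from [Y] and
    has at most [t] vertices. *)
Lemma omega_cograph_le t :
    (forall S : {set V}, #|S| = t.+1 -> ~~ [disjoint Y & pairs S]) ->
  (omega cograph <= #|K| + t)%N.
Proof.
move=> YS; apply/bigmax_leqP => Q /forall_inP clQ.
rewrite -(cardsID K Q) leq_add ?subset_leq_card ?subsetIr // leqNgt.
apply/negP => /subset_of_card[S sS /YS/pred0Pn[e /andP[/= eY]]].
rewrite inE => /andP[eS /cards2P[x [y [xy Exy]]]].
move: eS eY; rewrite Exy subUset !sub1set => /andP[/(subsetP sS) xS /(subsetP sS)].
move: xS; rewrite !inE => /andP[xK xQ] /andP[yK yQ] eY.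
have /forall_inP/(_ _ yQ)/implyP/(_ xy) := clQ _ xQ.
by rewrite /= /coadj eY (negbTE xK) andbF.
Qed.

End Cograph.

(** * Choice of parameters and the infinite family *)

Lemma ln_ge_half (R : realType) (x : R) : 2 <= x -> 2^-1 <= ln x.
Proof.
move=> x_ge2; have x_gt0 : 0 < x by lra.
have xV : x^-1 <= 2^-1 by rewrite lef_pV2 ?posrE //; lra.
have xV0 : 0 < x^-1 by rewrite invr_gt0.
have := @le_ln1Dx R (x^-1 - 1); rewrite [1 + _]addrC subrK lnV ?posrE // => /(_ _); lra.
Qed.

Lemma exists_iocp_le1_graph (R : realType) (k : nat) : (1 < k)%N ->
  exists H : fin_graph, [/\ (iocp H <= 1)%N, (k <= omega H)%N &
    2 / (5 * 98 ^+ 2) * ((omega H)%:R ^+ 2 / ln (omega H)%:R ^+ 2) <= (chi H)%:R :> R].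
Proof.
move=> k_gt1; have k_gt0 : (0 < k)%N by apply: ltnW.
have k_ge2 : 2 <= k%:R :> R by rewrite ler_nat.
have k_pos : 0 < k%:R :> R by lra.
set L : R := ln k%:R; have L_ge : 2^-1 <= L by apply: ln_ge_half.
(* The factor 96 is 32 * 3, because [ln (2 k^2) <= 3 ln k] for [k >= 2]. Sets of size [t.+1] are
   hit, so independent sets have at most [t] vertices. *)
pose t := Num.truncn (96 * k%:R * L).
have kL_ge0 : 0 <= 96 * k%:R * L by nra.
have t_le : t%:R <= 96 * k%:R * L by rewrite truncn_le.
have t_lt : 96 * k%:R * L < t.+1%:R by apply: truncnS_gt.
have t_gt0 : (0 < t)%N by rewrite truncn_gt0; nra.
have ln_le : ln (2 * k%:R ^+ 2) <= 3 * L.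
  rewrite /L [3 * _]mulr_natl -lnXn // ler_ln ?posrE ?exprn_gt0 ?mulr_gt0 ?exprn_gt0 //.
  by rewrite [leRHS]exprS ler_wpM2r // exprn_ge0 // ltW.
have lt_t : 32 * k%:R * ln (2 * k%:R ^+ 2 : R) < t.+1%:R.
  apply: le_lt_trans t_lt; have : k%:R * ln (2 * k%:R ^+ 2) <= k%:R * (3 * L) by rewrite ler_pM2l.
  lra.
have cV := card_ord (2 * k ^ 2).
have [Y YK YS] := sparse_K33_free k_gt0 cV (t_gt0 : 1 < t.+1)%N lt_t.
have [K _ cK] : exists2 K : {set 'I_(2 * k ^ 2)}, K \subset setT & #|K| = k.
  by apply: subset_of_card; rewrite cardsT card_ord; nia.
pose H := cograph Y K.
have linked (A1 A2 : {set H}) : #|A1| = 3 -> #|A2| = 3 -> [disjoint A1 & A2] ->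
  exists x y, [/\ x \in A1, y \in A2 & adj x y] by apply: cograph_linked.
have k_le : (k <= omega H)%N by rewrite -cK omega_cograph_ge.
exists H; split=> //; first exact: iocp_le1.
(* From [L >= 1/2] follows [k <= 2 k L], which raises 96 to 98. *)
have w_le : (omega H)%:R <= 98 * k%:R * L.
  apply: (@le_trans _ _ (k%:R + t%:R)); last by nra.
  by rewrite -natrD ler_nat -[X in (X + _)%N]cK omega_cograph_le.
(* The planted clique serves here: it keeps [ln (omega H)] from falling below [ln k], so that
   [omega H / ln (omega H) <= 98 k]. *)
have lnw_ge : L <= ln (omega H)%:R.
  by rewrite ler_ln ?posrE ?ler_nat // ltr0n (leq_trans k_gt0).
have chi_ge : 2 * k%:R ^+ 2 <= 5 * (chi H)%:R :> R.
  by have := card_le_chi linked; rewrite [#|_|]cV -natrX -!natrM ler_nat.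
have : (omega H)%:R ^+ 2 / ln (omega H)%:R ^+ 2 <= (98 * k%:R) ^+ 2 :> R.
  rewrite ler_pdivrMr ?exprn_gt0 //; last by lra.
  rewrite -exprMn lerXn2r ?nnegrE ?ler0n //; first by nra.
  by apply: (le_trans w_le); rewrite ler_pM2l // mulr_gt0.
lra.
Qed.

Theorem theorem10 (R : realType) :
  exists (c : R) (F : fin_graph -> Prop),
    [/\ 0 < c,
        infinite_family F,
        forall H : fin_graph, F H -> (iocp H <= 1)%N /\ (2 <= omega H)%N,
        forall m : nat, exists2 H : fin_graph, F H & (m < omega H)%N
      & forall H : fin_graph, F H ->
          (chi H)%:R >= c * ((omega H)%:R ^+ 2 / ln (omega H)%:R ^+ 2)].
Proof.
pose c : R := 2 / (5 * 98 ^+ 2).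
pose F (H : fin_graph) := [/\ (iocp H <= 1)%N, (2 <= omega H)%N &
  c * ((omega H)%:R ^+ 2 / ln (omega H)%:R ^+ 2) <= (chi H)%:R].
have unbounded m : exists2 H, F H & (m < omega H)%N.
  have [H [iocpH omegaH chiH]] := @exists_iocp_le1_graph R m.+2 isT.
  by exists H; [split=> //; apply: leq_trans omegaH | apply: ltnW].
exists c, F; split=> //; first by rewrite divr_gt0 ?mulr_gt0 ?exprn_gt0.
(* A clique number above all those listed excludes isomorphism with any listed graph. *)
- move=> n u; have [H FH ltH] := unbounded (\max_i omega (u i)).
  exists H => // i /omega_isomorphic; apply/negP; rewrite -ltnNge.
  exact: leq_ltn_trans (leq_bigmax i) ltH.
- by move=> H [].
- by move=> H [].
Qed.
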